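(* Let $l\in\mathbb{Z}_{>0}$ and let $X=(X_1,\ldots,X_l)$ be an $l$-symbol. There exists an injective map $f:\mathcal{H}^{CJ}(X)\to\mathcal{H}^{BGO}(X)$ such that, whenever $f(a,b,i,j)=(a',b',i',j')$, we have $|a-b|=a'-b'$ and $\{i,j\}=\{i',j'\}$. More specifically, $f$ can be chosen so that moreover: if $(a,b,i,j)\in\mathcal{H}^{CJ}(X)$ and $(a,b,i,j)\notin\mathcal{H}^{BGO}(X)$, then $f(a,b,i,j)=(a',b',i',j')\notin\mathcal{H}^{CJ}(X)$ and $(i',j')=(j,i)$; and the restriction of $f$ to $\mathcal{H}^{CJ}(X)\cap\mathcal{H}^{BGO}(X)$ is the identity map.
   Context: $\mathbb{N}=\mathbb{Z}_{\ge 0}$. A $\beta$-set of charge $m$ is a finite strictly increasing sequence $(a_1,\ldots,a_m)$ of elements of $\mathbb{N}$, identified with the set of its entries. An $l$-symbol is an $l$-tuple $X=(X_1,\ldots,X_l)$ of $\beta$-sets. Set $\Gamma_j=\mathbb{N}\setminus X_j$ for $1\le j\le l$. A hook in $X$ is a quadruple $(a,b,i,j)$ with $a,b\in\mathbb{N}$, $1\le i,j\le l$, $a\in X_i$ and $b\in\Gamma_j$. A BGO-hook in $X$ is a hook $(a,b,i,j)$ such that $a\ge b$ and, if $a=b$, then $i>j$. A CJ-hook in $X$ is a hook $(a,b,i,j)$ such that $\sharp\{\gamma\in\Gamma_i\mid a>\gamma\}>\sharp\{\gamma\in\Gamma_j\mid b>\gamma\}$. The sets of BGO-hooks and CJ-hooks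 in $X$ are denoted $\mathcal{H}^{BGO}(X)$ and $\mathcal{H}^{CJ}(X)$. *)

(* Defs.v *)
From mathcomp Require Import all_boot.
Set Implicit Arguments.
Unset Strict Implicit.
Unset Printing Implicit Defensive.

(* The charge of a beta-set is the size of the underlying sequence; the
   components of an l-symbol may have different charges. *)
Record betaset := BetaSet {
  betaset_seq :> seq nat;
  betaset_sorted : sorted ltn betaset_seq
}.

(* The components are indexed by 0, ..., l - 1 instead of 1, ..., l. *)
Definition lsymbol (l : nat) := l.-tuple betaset.

Definition Gamma (l : nat) (X : lsymbol l) (j : 'I_l) : pred nat :=
  [pred g | g \notin (tnth X j : seq nat)].

Definition quad (l : nat) := (nat * nat * 'I_l * 'I_l)%type.

Definition hooks (l : nat) (X : lsymbol l) : pred (quad l) :=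
  [pred h : quad l | let: (a, b, i, j) := h in
    (a \in (tnth X i : seq nat)) && (b \in Gamma X j)].

Definition BGO_hooks (l : nat) (X : lsymbol l) : pred (quad l) :=
  [pred h : quad l | (h \in hooks X) &&
    (let: (a, b, i, j) := h in (b <= a) && ((a == b) ==> (j < i)))].

(* An element of 'I_a is a natural number smaller than a, so the two sets below
   are {g in Gamma_j | b > g} and {g in Gamma_i | a > g}. *)
Definition CJ_hooks (l : nat) (X : lsymbol l) : pred (quad l) :=
  [pred h : quad l | (h \in hooks X) &&
    (let: (a, b, i, j) := h in
      #|[set g : 'I_b | val g \in Gamma X j]|
        < #|[set g : 'I_a | val g \in Gamma X i]|)].

(* Main.v *)
Require Import Defs.
From mathcomp Require Import all_boot all_order all_algebra.
From mathcomp Require Import zify.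
Import Order.TTheory GRing.Theory Num.Theory.
Local Open Scope ring_scope.

Set Implicit Arguments.
Unset Strict Implicit.
Unset Printing Implicit Defensive.

(** Fix two components i, j and a length d >= 0, and walk along the integers with
    D n = #{gaps of X_i below n} - #{gaps of X_j below n + d}.
    The walk moves by at most one at each time and starts at
    D 0 = - #{gaps of X_j below d} <= 0.  It goes down at time a exactly when
    a is in X_i and a + d is a gap of X_j, that is when (a, a + d, i, j) is a
    hook, and this hook is a CJ-hook exactly when D a > 0.  It goes up at time m
    exactly when (m + d, m, j, i) is a hook, and this one is a CJ-hook exactly
    when D m < 0.

    A CJ-hook (a, b, i, j) that is not a BGO-hook has a <= b, so with d = b - a it
    is a descent of the walk from a level D a > 0.  As the walk started at a level
    <= 0, it has climbed to the level D a before; the last ascent from D a - 1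
    to D a before time a, say at time m, is matched with this descent, as an opening
    parenthesis with its closing one.  Then D m = D a - 1 >= 0, so the hook
    (m + d, m, j, i) is not a CJ-hook, and it is a BGO-hook: for d > 0 by
    comparing its entries, and for d = 0 since then i < j.  The matching is
    injective ([last_ascent_inj]), and the new hook determines i, j and d.
    The CJ-hooks that are BGO-hooks are kept fixed; their images are CJ-hooks and
    so do not collide with the new ones. *)

(** The maximum ranges over a nonempty set as soon as [D 0 < D n], so its default
    value [0] is not returned by mistake in that case. *)
Definition last_ascent (D : nat -> int) (n : nat) : nat :=
  \max_(m < n | D m < D n) m.

Lemma last_ascent_max {D : nat -> int} {n k : nat} :
  (last_ascent D n < k < n)%N -> D n <= D k.
Proof.
case/andP=> lt_mk lt_kn; rewrite leNgt; apply/negP => Dk.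
have := @leq_bigmax_cond _ (fun m : 'I_n => D m < D n) (@nat_of_ord n)
          (Ordinal lt_kn) Dk.
by rewrite leqNgt lt_mk.
Qed.

(** Just after the last time below the level [D n] the walk is at [D n] or
    above, and a climb by at most one leaves no choice for the two levels. *)
Lemma last_ascentP {D : nat -> int} {n : nat} :
  (forall m, D m.+1 <= D m + 1) -> D 0%N < D n ->
  [/\ (last_ascent D n < n)%N, D n = D (last_ascent D n) + 1
    & D (last_ascent D n).+1 = D n].
Proof.
move=> climb D0n.
have n_gt0 : (0 < n)%N by case: n D0n => //; rewrite ltxx.
have A0 : (0 < #|[pred m : 'I_n | D m < D n]%R|)%N.
  by apply/card_gt0P; exists (Ordinal n_gt0).
have [m Dm def_m] := eq_bigmax_cond (@nat_of_ord n) A0.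
have eq_m : last_ascent D n = m by rewrite -def_m.
rewrite inE /= in Dm.
have Dm1 : D n <= D m.+1.
  have := ltn_ord m; rewrite leq_eqVlt => /predU1P[-> // | lt_m1n].
  by apply: last_ascent_max; rewrite eq_m ltnSn.
have := climb m; rewrite eq_m; split; [exact: ltn_ord | lia | lia].
Qed.

(** Between two descents matched with the same ascent, the first descent would
    bring the walk below the level of the second one, after that ascent. *)
Lemma last_ascent_inj {D : nat -> int} {n1 n2 : nat} :
  (forall m, D m.+1 <= D m + 1) ->
  D 0%N < D n1 -> D 0%N < D n2 -> D n1.+1 < D n1 -> D n2.+1 < D n2 ->
  last_ascent D n1 = last_ascent D n2 -> n1 = n2.
Proof.
move=> climb.
wlog lt_n : n1 n2 / (n1 < n2)%N => [ih | D1 D2 dn1 _ eq_m].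
  by case: (ltngtP n1 n2) => // lt_n D1 D2 dn1 dn2 eq_m; [|symmetry]; apply: ih.
have [lt1 E1 _] := last_ascentP climb D1.
have [_ E2 _] := last_ascentP climb D2.
have eqD : D n1 = D n2 by rewrite E1 E2 eq_m.
have lt_n1 : (n1.+1 < n2)%N.
  rewrite ltn_neqAle lt_n andbT; apply/eqP => eq_n.
  by rewrite -eq_n in eqD; rewrite eqD ltxx in dn1.
have := last_ascent_max (D := D) (n := n2) (k := n1.+1); rewrite -eq_m lt_n1 andbT => /(_ (ltnW lt1)).
lia.
Qed.

Section Walk.

Variables (l : nat) (X : lsymbol l).
Implicit Types (i j : 'I_l) (a b d m n : nat).

Definition gaps i n : nat := #|[set g : 'I_n | val g \in Gamma X i]|.

Lemma gaps0 i : gaps i 0 = 0%N.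
Proof. by apply: eq_card0 => -[]. Qed.

Lemma gapsS i n : gaps i n.+1 = (gaps i n + (n \notin (tnth X i : seq nat)))%N.
Proof.
have gapsE k : gaps i k = (\sum_(g < k) (val g \in Gamma X i))%N.
  by rewrite /gaps cardsE -sum1_card big_mkcond.
by rewrite !gapsE big_ord_recr.
Qed.

Lemma gaps_mono i : {homo gaps i : m n / (m <= n)%N}.
Proof.
by apply: (homo_leq leqnn leq_trans) => n; rewrite gapsS leq_addr.
Qed.

Definition gap_walk i j d n : int := (gaps i n)%:Z - (gaps j (n + d))%:Z.

Lemma gap_walk0 i j d : gap_walk i j d 0 <= 0.
Proof. by rewrite /gap_walk gaps0; lia. Qed.

Lemma gap_walkS i j d n :
  gap_walk i j d n.+1 = gap_walk i j d n
    + (n \notin (tnth X i : seq nat))%:Z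
    - ((n + d)%N \notin (tnth X j : seq nat))%:Z.
Proof. by rewrite /gap_walk addSn !gapsS; lia. Qed.

Lemma gap_walk_climb i j d n : gap_walk i j d n.+1 <= gap_walk i j d n + 1.
Proof. by rewrite gap_walkS; do 2!case: (_ \notin _); lia. Qed.

(** The CJ-hooks that are not BGO-hooks are descents of a walk from a positive
    level.  They join two different components because the number of gaps of a
    single one below a given bound increases with the bound. *)
Lemma CJ_notBGO a b i j :
    (a, b, i, j) \in CJ_hooks X -> (a, b, i, j) \notin BGO_hooks X ->
  [/\ (a <= b)%N, (a == b) ==> (i < j)%N, 0 < gap_walk i j (b - a) a
    & gap_walk i j (b - a) a.+1 < gap_walk i j (b - a) a].
Proof.
rewrite !inE => /andP[/andP[Xa Xb] CJ].
rewrite -/(gaps i a) -/(gaps j b) in CJ.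
rewrite Xa Xb /= => nBGO.
have le_ab : (a <= b)%N.
  by case: (leqP a b) => // lt_ba; move: nBGO; rewrite ltnW // gtn_eqF.
have neq_ij : i != j.
  by apply/eqP => eq_ij; move: CJ; rewrite eq_ij ltnNge gaps_mono.
split=> //.
- apply/implyP => eq_ab; move: nBGO; rewrite eq_ab -(eqP eq_ab) leqnn /=.
  by rewrite -leqNgt ltn_neqAle neq_ij.
- by rewrite /gap_walk subnKC //; lia.
- by rewrite gap_walkS subnKC // Xa Xb; lia.
Qed.

Definition CJ_to_BGO (h : quad l) : quad l :=
  if h \in BGO_hooks X then h else
  let: (a, b, i, j) := h in
  let m := last_ascent (gap_walk i j (b - a)) a in (m + (b - a), m, j, i)%N.

Lemma CJ_to_BGO_fixed h : h \in BGO_hooks X -> CJ_to_BGO h = h.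
Proof. by rewrite /CJ_to_BGO => ->. Qed.

Lemma CJ_to_BGO_moved a b i j : (a, b, i, j) \notin BGO_hooks X ->
  let m := last_ascent (gap_walk i j (b - a)) a in
  CJ_to_BGO (a, b, i, j) = (m + (b - a), m, j, i)%N.
Proof. by rewrite /CJ_to_BGO => /negbTE->. Qed.

Lemma CJ_to_BGO_movedP h : h \in CJ_hooks X -> h \notin BGO_hooks X ->
  CJ_to_BGO h \in BGO_hooks X /\ CJ_to_BGO h \notin CJ_hooks X.
Proof.
case: h => [[[a b] i] j] hCJ hBGO; rewrite CJ_to_BGO_moved //=.
have [le_ab lt_ij D_gt0 _] := CJ_notBGO hCJ hBGO.
set d := (b - a)%N in D_gt0 *; set m := last_ascent _ _.
have [_ Dm Dm1] :=
  last_ascentP (gap_walk_climb i j d) (le_lt_trans (gap_walk0 i j d) D_gt0).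
rewrite -/m in Dm Dm1.
(* The walk goes up at time m, so m is a gap of X_i and m + d is not one of X_j. *)
have [Xm Xmd] :
    (m \notin (tnth X i : seq nat)) /\ ((m + d)%N \in (tnth X j : seq nat)).
  by move: Dm1; rewrite gap_walkS; do 2!case: (_ \in _) => //=; lia.
rewrite !inE Xm Xmd /= leq_addr /= -leqNgt; split.
  apply/implyP => /eqP eq_md; apply: (implyP lt_ij); apply/eqP.
  by move: le_ab eq_md; rewrite /d; lia.
rewrite -/(gaps j (m + d)) -/(gaps i m).
by move: Dm D_gt0; rewrite {2}/gap_walk; lia.
Qed.

Lemma CJ_to_BGO_hook h : h \in CJ_hooks X -> CJ_to_BGO h \in BGO_hooks X.
Proof.
move=> hCJ; case: (boolP (h \in BGO_hooks X)) => hBGO.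
  by rewrite CJ_to_BGO_fixed.
by have [] := CJ_to_BGO_movedP hCJ hBGO.
Qed.

Lemma CJ_to_BGO_inj : {in CJ_hooks X &, injective CJ_to_BGO}.
Proof.
move=> h1 h2 CJ1 CJ2.
case: (boolP (h1 \in BGO_hooks X)) => B1; case: (boolP (h2 \in BGO_hooks X)) => B2.
- by rewrite !CJ_to_BGO_fixed.
- rewrite (CJ_to_BGO_fixed B1) => eq_h.
  by have [_] := CJ_to_BGO_movedP CJ2 B2; rewrite -eq_h CJ1.
- rewrite (CJ_to_BGO_fixed B2) => eq_h.
  by have [_] := CJ_to_BGO_movedP CJ1 B1; rewrite eq_h CJ2.
case: h1 h2 => [[[a1 b1] i1] j1] [[[a2 b2] i2] j2] in CJ1 CJ2 B1 B2 *.
have [le1 _ pos1 down1] := CJ_notBGO CJ1 B1.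
have [le2 _ pos2 down2] := CJ_notBGO CJ2 B2.
rewrite !CJ_to_BGO_moved //= => -[eq_md eq_m eq_j eq_i].
subst i2 j2.
have eq_d : (b2 - a2)%N = (b1 - a1)%N by move: eq_md eq_m; lia.
rewrite eq_d in pos2 down2 eq_m.
have D0 := gap_walk0 i1 j1 (b1 - a1).
have eq_a := last_ascent_inj (gap_walk_climb i1 j1 (b1 - a1))
  (le_lt_trans D0 pos1) (le_lt_trans D0 pos2) down1 down2 eq_m.
by subst a2; congr (_, _, _, _); lia.
Qed.

End Walk.

Theorem proposition2p1p7 (l : nat) (hl : (0 < l)%N) (X : lsymbol l) :
  exists f : {h : quad l | h \in CJ_hooks X} -> {h : quad l | h \in BGO_hooks X},
    [/\ injective f,
        forall h : {h : quad l | h \in CJ_hooks X}, let: (a, b, i, j) := sval h in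
                  let: (a', b', i', j') := sval (f h) in
          `|a%:Z - b%:Z| = a'%:Z - b'%:Z /\ [set i; j] = [set i'; j'],
        forall h : {h : quad l | h \in CJ_hooks X}, sval h \notin BGO_hooks X ->
          let: (a, b, i, j) := sval h in
          let: (a', b', i', j') := sval (f h) in
          sval (f h) \notin CJ_hooks X /\ (i', j') = (j, i)
      & forall h : {h : quad l | h \in CJ_hooks X}, sval h \in BGO_hooks X -> sval (f h) = sval h].
Proof.
exists (fun h => exist _ (CJ_to_BGO X (sval h)) (CJ_to_BGO_hook (svalP h))).
split=> /=.
- move=> h1 h2 /(congr1 sval) /= eq_f; apply: val_inj.
  exact: CJ_to_BGO_inj (svalP h1) (svalP h2) eq_f.
- case=> -[[[a b] i] j] hCJ /=.
  case: (boolP ((a, b, i, j) \in BGO_hooks X)) => hBGO.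
    rewrite CJ_to_BGO_fixed //; split=> //.
    by move: hBGO; rewrite !inE => /andP[_ /andP[le_ba _]]; lia.
  have [le_ab _ _ _] := CJ_notBGO hCJ hBGO.
  by rewrite CJ_to_BGO_moved //=; split; [lia | rewrite setUC].
- case=> -[[[a b] i] j] hCJ /= hBGO.
  have [_] := CJ_to_BGO_movedP hCJ hBGO.
  by rewrite CJ_to_BGO_moved.
- by move=> h; apply: CJ_to_BGO_fixed.
Qed.
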